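(* Let $f(z)=zh(z)\overline{g(z)}\in\mathcal{C}_{Lh}$. Then for all $z\in\mathbb{D}$: (1) $\displaystyle |h(z)|\le\frac{1}{1-|z|}\exp\left(\frac{|z|}{1-|z|}\right)$; (2) $\displaystyle |g(z)|\le\exp\left(\frac{|z|}{1-|z|}\right)$; (3) $\displaystyle |f(z)|\le\frac{|z|}{1-|z|}\exp\left(\frac{2|z|}{1-|z|}\right)$. Moreover, for each of (1), (2), (3), equality occurs at some $z\in\mathbb{D}\setminus\{0\}$ if and only if $f$ is of the form $f(z)=\overline{\eta}f_{1/2}(\eta z)$ for some $\eta\in\mathbb{C}$ with $|\eta|=1$, where $$f_{1/2}(z)=\frac{z}{1-z}\exp\left(\operatorname{Re}\left(\frac{2z}{1-z}\right)\right).$$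
   Context: $\mathbb{D}$ is the open unit disk in $\mathbb{C}$. A log-harmonic mapping on $\mathbb{D}$ is a solution $f$ of $$\overline{f_{\overline{z}}(z)}=\mu(z)\left(\frac{\overline{f(z)}}{f(z)}\right)f_z(z)$$ for some analytic $\mu:\mathbb{D}\to\mathbb{C}$ with $|\mu(z)|<1$ on $\mathbb{D}$. For $f=zh\overline{g}$ with $h,g$ analytic and non-vanishing, the dilatation is $\mu(z)=\dfrac{zg'(z)/g(z)}{1+zh'(z)/h(z)}$. $\mathcal{S}_{Lh}$ is the class of univalent (injective) log-harmonic mappings $f(z)=zh(z)\overline{g(z)}$ on $\mathbb{D}$ with $h,g$ analytic in $\mathbb{D}$, $h(0)=g(0)=1$, of the form $h=\exp(\sum_{n\ge1}a_nz^n)$, $g=\exp(\sum_{n\ge1}b_nz^n)$ (in particular $h,g$ are non-vanishing). $\mathcal{C}_{Lh}$ is the subclass of those $f=zh\overline{g}\in\mathcal{S}_{Lh}$ with $\dfrac{zh(z)}{g(z)}=\dfrac{z}{1-z}$ on $\mathbb{D}$. *)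

(* Defs.v *)
From Stdlib Require Import Reals.
From Coquelicot Require Import Coquelicot.

Open Scope C_scope.

Definition in_disk (z : C) : Prop := (Cmod z < 1)%R.

Definition Cexp (z : C) : C :=
  ((exp (Re z) * cos (Im z))%R, (exp (Re z) * sin (Im z))%R).

(* The codomain is fixed so that the derivative is the complex one: [C] also
   carries a normed-module structure over the reals. *)
Definition analytic_on_disk (f : C -> C) : Prop :=
  forall z : C, in_disk z -> @ex_derive C_AbsRing C_NormedModule f z.

Definition partial_x (f : C -> C) (z : C) : C :=
  (Derive (fun t : R => Re (f (t, Im z))) (Re z),
   Derive (fun t : R => Im (f (t, Im z))) (Re z)).

Definition partial_y (f : C -> C) (z : C) : C :=
  (Derive (fun t : R => Re (f (Re z, t))) (Im z),
   Derive (fun t : R => Im (f (Re z, t))) (Im z)).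

Definition dz (f : C -> C) (z : C) : C :=
  (partial_x f z - Ci * partial_y f z) / 2.

Definition dzbar (f : C -> C) (z : C) : C :=
  (partial_x f z + Ci * partial_y f z) / 2.

Definition real_differentiable (f : C -> C) (z : C) : Prop :=
  @ex_filterdiff R_AbsRing C_R_NormedModule C_R_NormedModule f (locally z).

(* Real differentiability makes the total operator [Derive] meaningful in
   [dz] and [dzbar].  The equation is asked only where f does not vanish,
   since it divides by f. *)
Definition log_harmonic (f : C -> C) : Prop :=
  (forall z : C, in_disk z -> real_differentiable f z) /\
  exists mu : C -> C,
    analytic_on_disk mu /\
    (forall z : C, in_disk z -> (Cmod (mu z) < 1)%R) /\
    (forall z : C, in_disk z -> f z <> 0 ->
       Cconj (dzbar f z) = mu z * (Cconj (f z) / f z) * dz f z).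

Definition univalent (f : C -> C) : Prop :=
  forall z w : C, in_disk z -> in_disk w -> f z = f w -> z = w.

Definition exp_of_power_series (h : C -> C) : Prop :=
  exists a : nat -> C,
    a O = 0 /\
    forall z : C, in_disk z ->
      exists s : C, @is_pseries C_AbsRing C_NormedModule a z s /\ h z = Cexp s.

(* The factors h and g are determined by f on the disk (h(0) = g(0) = 1), so
   they are kept as parameters of the classes. *)
Record S_Lh (f h g : C -> C) : Prop := {
  S_Lh_factor : forall z : C, in_disk z -> f z = z * h z * Cconj (g z);
  S_Lh_log_harmonic : log_harmonic f;
  S_Lh_univalent : univalent f;
  S_Lh_analytic_h : analytic_on_disk h;
  S_Lh_analytic_g : analytic_on_disk g;
  S_Lh_h0 : h 0 = 1;
  S_Lh_g0 : g 0 = 1;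
  S_Lh_exp_h : exp_of_power_series h;
  S_Lh_exp_g : exp_of_power_series g
}.

Definition C_Lh (f h g : C -> C) : Prop :=
  S_Lh f h g /\
  forall z : C, in_disk z -> z * h z / g z = z / (1 - z).

Definition f_half (z : C) : C :=
  z / (1 - z) * RtoC (exp (Re (2 * z / (1 - z)))).

Definition rotation_of_f_half (f : C -> C) : Prop :=
  exists eta : C, Cmod eta = 1%R /\
    forall z : C, in_disk z -> f z = Cconj eta * f_half (eta * z).

(* Main.v *)
Require Import Defs.
From Stdlib Require Import Reals ZArith Lra Lia.
From Coquelicot Require Import Coquelicot.

(** Write [g = exp B] with [B z = sum b_n z^n].  On the disk [h = g / (1 - z)]
    and [f = z / (1 - z) * |g|^2], so all three estimates, and the equality
    cases, reduce to [|g| = exp (Re B)].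

    The Wirtinger derivatives of [f = z h conj g] turn [|mu| < 1] into
    [|w| <= |1 + w|], that is [Re (1 + 2 w) >= 0], for
    [w z = z (1 - z) B' z] ([C_Lh_carath]).  The coefficients of [w] are
    [w_n = n b_n - (n - 1) b_(n-1)], and Caratheodory's inequality for power
    series with nonnegative real part gives [|w_n| <= 1]
    ([caratheodory_coefficient_bound]).  The sum telescopes:
    [n b_n = w_1 + ... + w_n], hence [|b_n| <= 1] ([coefficient_bound]) and
    [Re (B z) <= sum_(n >= 1) |z|^n = |z| / (1 - |z|)] ([Re_pseries_le]).

    If equality holds at some [z <> 0], then [b_n z^n = |z|^n] for all
    [n >= 1], so [b_n = b_1^n] with [|b_1| = 1].  Now
    [w_2 = b_1 (2 b_1 - 1)] has modulus at most 1, which forces [b_1 = 1]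
    ([extremal_coefficients]); then [B z = z / (1 - z)] and [f = f_half], the
    rotation by 1.

    Conversely, [f] has the argument of [z / (1 - z)].  A rotation of [f_half]
    by [eta] has that argument only when [eta = 1], as the points 1/2 and i/2
    already show, and then the bounds are attained at 1/2
    ([rotation_at_half]). *)

Local Open Scope R_scope.

(** * Complex-valued curves *)

(** The derivative of a curve in the plane, taken coordinatewise so that the
    one-variable calculus of real functions applies. *)
Definition curve_derivative (phi : R -> C) (t : R) (d : C) : Prop :=
  is_derive (fun s => Re (phi s)) t (Re d) /\
  is_derive (fun s => Im (phi s)) t (Im d).

Lemma curve_derivative_unique : forall (phi : R -> C) (t : R) (d d' : C),
  curve_derivative phi t d -> curve_derivative phi t d' -> d = d'.
Proof.
  intros phi t d d' [H1 H2] [H1' H2'].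
  apply is_derive_unique in H1, H2, H1', H2'.
  apply injective_projections;
    [change (Re d = Re d') | change (Im d = Im d')]; congruence.
Qed.

Lemma curve_derivative_ext_loc :
  forall (phi psi : R -> C) (t : R) (d : C),
  locally t (fun s => phi s = psi s) ->
  curve_derivative phi t d -> curve_derivative psi t d.
Proof.
  intros phi psi t d Hloc [H1 H2].
  split; (eapply is_derive_ext_loc; [|eassumption]);
    revert Hloc; apply filter_imp; intros s ->; reflexivity.
Qed.

Lemma curve_derivative_mult : forall (phi psi : R -> C) (t : R) (d e : C),
  curve_derivative phi t d -> curve_derivative psi t e ->
  curve_derivative (fun s => (phi s * psi s)%C) t (d * psi t + phi t * e)%C.
Proof.
  intros phi psi t d e [H1 H2] [K1 K2].
  split; simpl.
  - replace (fst d * fst (psi t) - snd d * snd (psi t)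
             + (fst (phi t) * fst e - snd (phi t) * snd e))
      with (Re d * Re (psi t) + Re (phi t) * Re e
            - (Im d * Im (psi t) + Im (phi t) * Im e))
      by (unfold Re, Im; ring).
    apply (@is_derive_minus R_AbsRing R_NormedModule);
      apply (is_derive_mult (K := R_AbsRing)); auto; apply Rmult_comm.
  - replace (fst d * snd (psi t) + snd d * fst (psi t)
             + (fst (phi t) * snd e + snd (phi t) * fst e))
      with (Re d * Im (psi t) + Re (phi t) * Im e
            + (Im d * Re (psi t) + Im (phi t) * Re e))
      by (unfold Re, Im; ring).
    apply (@is_derive_plus R_AbsRing R_NormedModule);
      apply (is_derive_mult (K := R_AbsRing)); auto; apply Rmult_comm.
Qed.

Lemma curve_derivative_conj : forall (phi : R -> C) (t : R) (d : C),
  curve_derivative phi t d ->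
  curve_derivative (fun s => Cconj (phi s)) t (Cconj d).
Proof.
  intros phi t d [H1 H2]. split; [exact H1|].
  apply (@is_derive_opp R_AbsRing R_NormedModule). exact H2.
Qed.

(** The chain rule for a complex derivative along a line of direction [v].
    Complex differentiability lives over the topology of the complex absolute
    value and real differentiability over the product topology, so the two
    notions are linked by hand through difference quotients. *)
Lemma curve_derivative_along_line :
  forall (F : C -> C) (z l v : C) (gamma : R -> C) (t : R),
    @is_derive C_AbsRing C_NormedModule F z l ->
    gamma t = z ->
    (forall h : R, gamma (t + h) = (z + RtoC h * v)%C) ->
    curve_derivative (fun s => F (gamma s)) t (l * v)%C.
Proof.
  intros F z l v gamma t [_ HF] Ht Hgamma.
  (* Both real quotients are bounded by the complex one. *)
  assert (key : forall eps : R, 0 < eps ->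
    exists delta : posreal, forall h : R, h <> 0 -> Rabs h < delta ->
      Cmod ((F (gamma (t + h)%R) - F (gamma t)) / RtoC h - l * v)%C < eps).
  { intros eps Heps.
    assert (Hv := Cmod_ge_0 v).
    assert (He : 0 < eps / (1 + Cmod v)) by (apply Rdiv_lt_0_compat; lra).
    destruct (HF z (fun P H => H) (mkposreal _ He)) as [d Hd].
    assert (Hdelta : 0 < d / (1 + Cmod v)).
    { apply Rdiv_lt_0_compat; [apply cond_pos | lra]. }
    exists (mkposreal _ Hdelta). simpl. intros h Hh0 Hh.
    specialize (Hd (gamma (t + h))).
    rewrite Hgamma, Ht. rewrite Hgamma in Hd.
    assert (Hab : 0 < Rabs h) by (now apply Rabs_pos_lt).
    assert (Hdist : (z + RtoC h * v - z = RtoC h * v)%C) by ring.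
    assert (Hb : Rabs h * (1 + Cmod v) < d).
    { apply (Rmult_lt_compat_r (1 + Cmod v)) in Hh; [|lra].
      replace (d / (1 + Cmod v) * (1 + Cmod v)) with (pos d) in Hh
        by (field; lra). exact Hh. }
    assert (Hnear : Cmod ((z + RtoC h * v) - z)%C < d).
    { rewrite Hdist, Cmod_mult, Cmod_R. nra. }
    apply Hd in Hnear.
    change (Cmod ((F (z + RtoC h * v) - F z) - ((z + RtoC h * v) - z) * l)%C
            <= eps / (1 + Cmod v) * Cmod ((z + RtoC h * v) - z)%C) in Hnear.
    rewrite Hdist in Hnear.
    assert (Hh0' : RtoC h <> 0%C) by (intro E; apply Hh0; now injection E).
    replace ((F (z + RtoC h * v) - F z) / RtoC h - l * v)%C
      with (((F (z + RtoC h * v) - F z) - RtoC h * v * l) / RtoC h)%C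
      by (now field).
    rewrite Cmod_div, Cmod_R by exact Hh0'.
    rewrite Cmod_mult, Cmod_R in Hnear.
    apply Rmult_lt_reg_r with (Rabs h); [exact Hab|].
    unfold Rdiv at 1. rewrite Rmult_assoc, Rinv_l, Rmult_1_r by lra.
    eapply Rle_lt_trans; [exact Hnear|].
    replace (eps / (1 + Cmod v) * (Rabs h * Cmod v))
      with (eps * Rabs h * (Cmod v / (1 + Cmod v))) by (field; lra).
    rewrite <- (Rmult_1_r (eps * Rabs h)) at 2.
    apply Rmult_lt_compat_l; [nra|].
    apply Rmult_lt_reg_r with (1 + Cmod v); [lra|].
    unfold Rdiv. rewrite Rmult_assoc, Rinv_l; lra. }
  split; apply is_derive_Reals; intros eps Heps;
    destruct (key eps Heps) as [d Hd]; exists d; intros h Hh0 Hh;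
    specialize (Hd h Hh0 Hh); eapply Rle_lt_trans; try exact Hd;
    eapply Rle_trans; [|apply Rmax_Cmod| |apply Rmax_Cmod].
  - eapply Rle_trans; [|apply Rmax_l]. right. f_equal.
    destruct (F (gamma (t + h))), (F (gamma t)), l, v; simpl; field; exact Hh0.
  - eapply Rle_trans; [|apply Rmax_r]. right. f_equal.
    destruct (F (gamma (t + h))), (F (gamma t)), l, v; simpl; field; exact Hh0.
Qed.

(** * Complex power series through their real and imaginary parts *)

Lemma pow_n_C : forall (z : C) (n : nat), @pow_n C_AbsRing z n = (z ^ n)%C.
Proof.
  intros z n. induction n as [|n IH]; simpl; [reflexivity|].
  rewrite IH. reflexivity.
Qed.

Lemma is_series_C : forall (a : nat -> C) (s : C),
  @is_series C_AbsRing C_NormedModule a s <->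
  is_series (fun n => Re (a n)) (Re s) /\ is_series (fun n => Im (a n)) (Im s).
Proof.
  intros a s.
  assert (Hsum : forall n, @sum_n C_NormedModule a n
            = (sum_n (fun k => Re (a k)) n, sum_n (fun k => Im (a k)) n)).
  { induction n as [|n IH].
    - rewrite !sum_O. now destruct (a O).
    - rewrite !sum_Sn, IH. reflexivity. }
  split.
  - intros H. split; intros P [d HP];
      destruct (H (fun c => ball s d c)) as [N HN]; try (now exists d);
      exists N; intros n Hn; apply HP;
      specialize (HN n Hn); rewrite Hsum in HN; apply HN.
  - intros [H1 H2] P [d HP].
    destruct (H1 (ball (Re s) d)) as [N1 HN1]; [now exists d|].
    destruct (H2 (ball (Im s) d)) as [N2 HN2]; [now exists d|].
    exists (max N1 N2). intros n Hn. apply HP.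
    rewrite Hsum.
    split; [apply HN1 | apply HN2]; lia.
Qed.

Lemma is_pseries_C : forall (a : nat -> C) (z s : C),
  @is_pseries C_AbsRing C_NormedModule a z s <->
  is_series (fun n => Re (a n * z ^ n)%C) (Re s) /\
  is_series (fun n => Im (a n * z ^ n)%C) (Im s).
Proof.
  intros a z s. rewrite <- (is_series_C (fun n => (a n * z ^ n)%C)).
  assert (E : forall n, @scal _ C_NormedModule (@pow_n C_AbsRing z n) (a n)
                        = (a n * z ^ n)%C).
  { intros n. rewrite pow_n_C. apply Cmult_comm. }
  split; intros H; (eapply is_series_ext; [|exact H]); intros n;
    [apply E | symmetry; apply E].
Qed.

Lemma is_pseries_C_unique : forall (a : nat -> C) (z s s' : C),
  @is_pseries C_AbsRing C_NormedModule a z s ->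
  @is_pseries C_AbsRing C_NormedModule a z s' -> s = s'.
Proof.
  intros a z [x y] [x' y'] H H'.
  apply is_pseries_C in H. apply is_pseries_C in H'.
  destruct H as [H1 H2], H' as [H1' H2']. simpl in *.
  apply is_series_unique in H1. apply is_series_unique in H2.
  apply is_series_unique in H1'. apply is_series_unique in H2'.
  congruence.
Qed.

Lemma CV_radius_ge_of_ex_series : forall (a : nat -> R) (t : R),
  0 <= t -> ex_series (fun n => a n * t ^ n) -> Rbar_le t (CV_radius a).
Proof.
  intros a t Ht Hex. apply Rbar_not_lt_le. intros Hlt.
  apply (CV_disk_outside a t).
  - now rewrite Rabs_pos_eq.
  - now apply ex_series_lim_0.
Qed.

Definition converges_on_disk (a : nat -> C) : Prop :=
  forall z : C, in_disk z ->
    exists s : C, @is_pseries C_AbsRing C_NormedModule a z s.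

Lemma Cmod_le_Re_Im : forall c : C, Cmod c <= Rabs (Re c) + Rabs (Im c).
Proof.
  intros [x y]. simpl.
  replace ((x, y) : C) with (RtoC x + RtoC y * Ci)%C
    by (apply injective_projections; simpl; ring).
  eapply Rle_trans; [apply Cmod_triangle|].
  rewrite Cmod_mult, Cmod_Ci, !Cmod_R. lra.
Qed.

(** Convergence at one larger radius makes the terms tend to 0 there, which
    gives absolute convergence. *)
Lemma ex_series_Cmod : forall (a : nat -> C) (r : R),
  converges_on_disk a -> 0 <= r < 1 ->
  ex_series (fun n => Cmod (a n) * r ^ n).
Proof.
  intros a r Ha Hr.
  assert (Hrho : 0 <= (r + 1) / 2 < 1) by lra.
  set (rho := (r + 1) / 2) in *.
  assert (Hrad : Rbar_le rho (CV_radius (fun n => Cmod (a n)))).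
  { apply Rbar_not_lt_le. intros Hlt.
    apply (CV_disk_outside (fun n => Cmod (a n)) rho).
    - now rewrite Rabs_pos_eq.
    - destruct (Ha (RtoC rho)) as [s Hs].
      { unfold in_disk. rewrite Cmod_R, Rabs_pos_eq; lra. }
      apply is_pseries_C in Hs. destruct Hs as [H1 H2].
      assert (L1 := ex_series_lim_0 _ (ex_intro _ _ H1)).
      assert (L2 := ex_series_lim_0 _ (ex_intro _ _ H2)).
      apply is_lim_seq_abs_0 in L1. apply is_lim_seq_abs_0 in L2.
      eapply is_lim_seq_le_le with (u := fun _ => 0)
        (w := fun n => Rabs (Re (a n * RtoC rho ^ n)%C)
                       + Rabs (Im (a n * RtoC rho ^ n)%C)).
      + intros n. assert (Hc := Cmod_ge_0 (a n)).
        assert (Hp : 0 <= rho ^ n) by (apply pow_le; lra).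
        split; [now apply Rmult_le_pos|].
        eapply Rle_trans; [|apply Cmod_le_Re_Im].
        rewrite Cmod_mult, Cmod_pow, Cmod_R, Rabs_pos_eq by lra. lra.
      + apply is_lim_seq_const.
      + replace (Finite 0) with (Finite (0 + 0)) by (f_equal; ring).
        now apply is_lim_seq_plus'. }
  eapply ex_series_ext; [|apply (CV_disk_inside (fun n => Cmod (a n)) r)].
  - intros n. simpl. apply Rabs_pos_eq.
    apply Rmult_le_pos; [apply Cmod_ge_0 | apply pow_le; lra].
  - eapply Rbar_lt_le_trans; [|exact Hrad]. simpl.
    rewrite Rabs_pos_eq by lra. unfold rho; lra.
Qed.

(** Meant for the real and imaginary parts of a complex power series on the ray
    through a point [z] that sits at parameter 1: since [z] is interior to the
    disk, convergence extends to some [t0 > 1]. *)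
Lemma radial_PSeries : forall (beta : nat -> R) (t0 : R),
  1 < t0 -> ex_series (fun n => beta n * t0 ^ n) ->
  (forall t : R, Rabs t < t0 ->
     is_series (fun n => beta n * t ^ n) (PSeries beta t)) /\
  exists d : R, is_derive (PSeries beta) 1 d /\
                is_series (fun n => INR n * beta n) d.
Proof.
  intros beta t0 Ht0 Hex.
  assert (Hrad := CV_radius_ge_of_ex_series beta t0 ltac:(lra) Hex).
  split.
  - intros t Ht. apply is_pseries_R, PSeries_correct, CV_radius_inside.
    eapply Rbar_lt_le_trans; [|exact Hrad]. exact Ht.
  - assert (H1 : Rbar_lt (Rabs 1) (CV_radius beta)).
    { eapply Rbar_lt_le_trans; [|exact Hrad]. simpl.
      rewrite Rabs_pos_eq; lra. }
    exists (PSeries (PS_derive beta) 1). split.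
    + now apply is_derive_PSeries.
    + apply is_series_decr_1. cbv beta.
      assert (H := PSeries_correct _ _ (ex_pseries_derive _ _ H1)).
      apply is_pseries_R in H.
      change (is_series (fun k => INR (S k) * beta (S k))
                (PSeries (PS_derive beta) 1 + - (0 * beta O))).
      replace (PSeries (PS_derive beta) 1 + - (0 * beta O))
        with (PSeries (PS_derive beta) 1) by ring.
      eapply is_series_ext; [|exact H].
      intros n. simpl. rewrite pow1, Rmult_1_r. reflexivity.
Qed.

(** The expansion [z * B' z = sum n b_n z^n] for [G = exp B].  As [G] is known
    to have a complex derivative, differentiating along the ray through [z] is
    enough, and there only real power series occur. *)
Lemma is_pseries_log_derivative :
  forall (b : nat -> C) (G : C -> C) (z l : C),
    (forall z : C, in_disk z ->
       exists s : C, @is_pseries C_AbsRing C_NormedModule b z s /\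
                     G z = Cexp s) ->
    in_disk z ->
    @is_derive C_AbsRing C_NormedModule G z l ->
    G z <> 0%C /\
    @is_pseries C_AbsRing C_NormedModule
      (fun n => RtoC (INR n) * b n)%C z (z * l / G z)%C.
Proof.
  intros b G z l HG Hz Hl.
  assert (Hq := Cmod_ge_0 z). unfold in_disk in Hz.
  (* Any [t0 > 1] with [t0 |z| < 1] will do. *)
  set (t0 := 1 + (1 - Cmod z) / 2).
  assert (Ht0 : 1 < t0) by (unfold t0; lra).
  assert (Hdisk : forall t : R, Rabs t <= t0 -> in_disk (RtoC t * z)).
  { intros t Ht. unfold in_disk. rewrite Cmod_mult, Cmod_R.
    unfold t0 in Ht. assert (0 <= Rabs t) by apply Rabs_pos. nra. }
  set (u := fun n => Re (b n * z ^ n)%C).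
  set (v := fun n => Im (b n * z ^ n)%C).
  assert (Hterm : forall t n,
    (b n * (RtoC t * z) ^ n = RtoC (t ^ n) * (b n * z ^ n))%C).
  { intros t n. rewrite Cpow_mult_l, <- RtoC_pow. ring. }
  assert (HRe : forall t n, u n * t ^ n = Re (b n * (RtoC t * z) ^ n)%C).
  { intros t n. rewrite Hterm. unfold u. simpl. ring. }
  assert (HIm : forall t n, v n * t ^ n = Im (b n * (RtoC t * z) ^ n)%C).
  { intros t n. rewrite Hterm. unfold v. simpl. ring. }
  destruct (HG (RtoC t0 * z)%C) as [s0 [Hs0 _]].
  { apply Hdisk. rewrite Rabs_pos_eq; lra. }
  apply is_pseries_C in Hs0. destruct Hs0 as [Hu0 Hv0].
  destruct (radial_PSeries u t0 Ht0) as [Hu [du [Hdu Hsu]]].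
  { eexists. eapply is_series_ext; [|exact Hu0]. intros n. symmetry.
    apply HRe. }
  destruct (radial_PSeries v t0 Ht0) as [Hv [dv [Hdv Hsv]]].
  { eexists. eapply is_series_ext; [|exact Hv0]. intros n. symmetry.
    apply HIm. }
  assert (Hexp : forall t : R, Rabs t < t0 ->
    G (RtoC t * z)%C = Cexp (PSeries u t, PSeries v t)).
  { intros t Ht. destruct (HG (RtoC t * z)%C) as [s [Hs ->]].
    { apply Hdisk. lra. }
    f_equal. eapply is_pseries_C_unique; [exact Hs|].
    apply is_pseries_C. split.
    - eapply is_series_ext; [|exact (Hu t Ht)]. intros n. apply HRe.
    - eapply is_series_ext; [|exact (Hv t Ht)]. intros n. apply HIm. }
  assert (Hloc : locally 1 (fun t => Rabs t < t0)).
  { assert (Hd : 0 < t0 - 1) by lra.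
    exists (mkposreal _ Hd). intros t Ht.
    change (Rabs (t - 1) < t0 - 1) in Ht.
    replace t with ((t - 1) + 1) by ring.
    eapply Rle_lt_trans; [apply Rabs_triang|].
    rewrite (Rabs_pos_eq 1); lra. }
  assert (D : curve_derivative (fun t => G (RtoC t * z)%C) 1 (l * z)%C).
  { apply (curve_derivative_along_line G z l z (fun t => (RtoC t * z)%C));
      [exact Hl | ring | intros h; rewrite RtoC_plus; ring]. }
  assert (HG1 : G z = Cexp (PSeries u 1, PSeries v 1)).
  { rewrite <- Hexp by (rewrite Rabs_pos_eq; lra). f_equal. ring. }
  assert (D' : curve_derivative (fun t => G (RtoC t * z)%C) 1
    (G z * (du, dv))%C).
  { apply curve_derivative_ext_loc
      with (fun t => Cexp (PSeries u t, PSeries v t)).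
    { revert Hloc. apply filter_imp. intros t Ht. symmetry. now apply Hexp. }
    rewrite HG1. split; simpl; auto_derive.
    - repeat split; try (now exists du); now exists dv.
    - replace (Derive (fun t => PSeries u t) 1) with du
        by (symmetry; now apply is_derive_unique).
      replace (Derive (fun t => PSeries v t) 1) with dv
        by (symmetry; now apply is_derive_unique).
      ring.
    - repeat split; try (now exists du); now exists dv.
    - replace (Derive (fun t => PSeries u t) 1) with du
        by (symmetry; now apply is_derive_unique).
      replace (Derive (fun t => PSeries v t) 1) with dv
        by (symmetry; now apply is_derive_unique).
      ring. }
  assert (Hkey := curve_derivative_unique _ _ _ _ D D').
  assert (HGz : G z <> 0%C).
  { rewrite HG1. apply Cmod_gt_0. unfold Cexp, Cmod. simpl.
    apply sqrt_lt_R0.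
    assert (Hsc := sin2_cos2 (PSeries v 1)). unfold Rsqr in Hsc.
    assert (He := exp_pos (PSeries u 1)).
    assert (0 < exp (PSeries u 1) * exp (PSeries u 1)) by nra. nra. }
  split; [exact HGz|].
  replace (z * l / G z)%C with ((du, dv) : C).
  2:{ assert (Hcancel : forall p : C, (p = G z * p / G z)%C)
        by (intros p; now field).
      rewrite (Cmult_comm z l), Hkey. apply Hcancel. }
  apply is_pseries_C. simpl. split.
  - eapply is_series_ext; [|exact Hsu]. intros n. unfold u. simpl. ring.
  - eapply is_series_ext; [|exact Hsv]. intros n. unfold v. simpl. ring.
Qed.

(** * Caratheodory's coefficient inequality *)

Lemma is_RInt_sum_eq : forall (f g k : R -> R) (a b If Ig Ik : R),
  is_RInt f a b If -> is_RInt g a b Ig ->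
  (forall x : R, k x = f x + g x) -> Ik = If + Ig -> is_RInt k a b Ik.
Proof.
  intros f g k a b If Ig Ik Hf Hg Hk ->.
  apply (is_RInt_ext (fun x => plus (f x) (g x))).
  - intros x _. symmetry. apply Hk.
  - now apply (@is_RInt_plus R_NormedModule).
Qed.

Lemma is_RInt_cos_sin : forall (j : Z) (A B : R),
  is_RInt (fun x => A * cos (IZR j * x) + B * sin (IZR j * x)) 0 (2 * PI)
    (if Z.eqb j 0 then 2 * PI * A else 0).
Proof.
  intros j A B. destruct (Z.eqb_spec j 0) as [->|Hj].
  - eapply is_RInt_ext with (f := fun _ => A).
    { intros x _. rewrite Rmult_0_l, cos_0, sin_0. simpl. ring. }
    replace (2 * PI * A) with ((2 * PI - 0) * A) by ring.
    apply (@is_RInt_const R_NormedModule).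
  - assert (Hj' : IZR j <> 0) by (now apply not_0_IZR).
    assert (Hper : cos (IZR j * (2 * PI)) = 1 /\ sin (IZR j * (2 * PI)) = 0).
    { replace (IZR j * (2 * PI)) with (2 * IZR j * PI) by ring.
      assert (Hpos : forall p, IZR (Z.pos p) = INR (Pos.to_nat p))
        by (intros p; now rewrite INR_IZR_INZ, positive_nat_Z).
      destruct j as [|p|p].
      - now destruct Hj.
      - rewrite <- (Rplus_0_l (2 * IZR (Z.pos p) * PI)), (Hpos p).
        rewrite cos_period, sin_period, cos_0, sin_0. now split.
      - replace (2 * IZR (Z.neg p) * PI) with (- (2 * IZR (Z.pos p) * PI))
          by (rewrite <- Pos2Z.opp_pos, opp_IZR; ring).
        rewrite cos_neg, sin_neg.
        rewrite <- (Rplus_0_l (2 * IZR (Z.pos p) * PI)), (Hpos p).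
        rewrite cos_period, sin_period, cos_0, sin_0. split; ring. }
    set (F := fun x => A / IZR j * sin (IZR j * x)
                       - B / IZR j * cos (IZR j * x)).
    replace 0 with (minus (F (2 * PI)) (F 0)) at 2.
    + apply (@is_RInt_derive R_CompleteNormedModule).
      * intros x _. unfold F. auto_derive; [exact I|]. now field.
      * intros x _.
        apply (ex_derive_continuous
                 (fun x => A * cos (IZR j * x) + B * sin (IZR j * x))).
        auto_derive. exact I.
    + unfold F, minus, plus, opp. simpl. destruct Hper as [-> ->].
      rewrite !Rmult_0_r, cos_0, sin_0. ring.
Qed.

(** For [gamma^2 + delta^2 <= 1] this is a nonnegative test function whose mean
    against a trigonometric sum isolates the frequencies 0 and [n]. *)
Definition kernel (n : nat) (gamma delta x : R) : R :=
  1 + (gamma * cos (INR n * x) + delta * sin (INR n * x)).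

Lemma is_RInt_kernel : forall (n : nat) (gamma delta : R),
  (1 <= n)%nat -> is_RInt (kernel n gamma delta) 0 (2 * PI) (2 * PI).
Proof.
  intros n gamma delta Hn.
  assert (H0 := is_RInt_cos_sin 0 1 0).
  assert (H1 := is_RInt_cos_sin (Z.of_nat n) gamma delta).
  replace (Z.eqb (Z.of_nat n) 0) with false in H1
    by (symmetry; apply Z.eqb_neq; lia).
  apply (is_RInt_sum_eq _ _ _ _ _ _ _ _ H0 H1).
  - intros x. unfold kernel.
    rewrite <- INR_IZR_INZ, Rmult_0_l, cos_0. ring.
  - simpl. ring.
Qed.

(** Orthogonality of trigonometric functions: after expanding the products, the
    frequencies [m] and [m + n] are nonzero and average out, and [m - n]
    survives only for [m = n]. *)
Lemma is_RInt_trig_kernel : forall (m n : nat) (alpha beta gamma delta : R),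
  (1 <= m)%nat -> (1 <= n)%nat ->
  is_RInt (fun x => (alpha * cos (INR m * x) - beta * sin (INR m * x))
                    * kernel n gamma delta x) 0 (2 * PI)
    (if Nat.eqb m n then PI * (alpha * gamma - beta * delta) else 0).
Proof.
  intros m n alpha beta gamma delta Hm Hn.
  assert (H0 := is_RInt_cos_sin (Z.of_nat m) alpha (- beta)).
  assert (H1 := is_RInt_cos_sin (Z.of_nat m - Z.of_nat n)
                  ((alpha * gamma - beta * delta) / 2)
                  (- (alpha * delta + beta * gamma) / 2)).
  assert (H2 := is_RInt_cos_sin (Z.of_nat m + Z.of_nat n)
                  ((alpha * gamma + beta * delta) / 2)
                  ((alpha * delta - beta * gamma) / 2)).
  replace (Z.eqb (Z.of_nat m) 0) with false in H0
    by (symmetry; apply Z.eqb_neq; lia).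
  replace (Z.eqb (Z.of_nat m + Z.of_nat n) 0) with false in H2
    by (symmetry; apply Z.eqb_neq; lia).
  replace (Z.eqb (Z.of_nat m - Z.of_nat n) 0) with (Nat.eqb m n) in H1.
  2:{ destruct (Nat.eqb_spec m n); symmetry;
        [apply Z.eqb_eq | apply Z.eqb_neq]; lia. }
  assert (H12 := is_RInt_sum_eq _ _ _ _ _ _ _ _ H1 H2
                   (fun x => eq_refl) eq_refl).
  apply (is_RInt_sum_eq _ _ _ _ _ _ _ _ H0 H12).
  - intros x. unfold kernel. rewrite minus_IZR, plus_IZR, <- !INR_IZR_INZ.
    replace ((INR m - INR n) * x) with (INR m * x - INR n * x) by ring.
    replace ((INR m + INR n) * x) with (INR m * x + INR n * x) by ring.
    rewrite cos_minus, cos_plus, sin_minus, sin_plus. field.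
  - destruct (Nat.eqb m n); field.
Qed.

Definition on_circle (r x : R) : C := (r * cos x, r * sin x).

Lemma on_circle_pow : forall (r x : R) (n : nat),
  (on_circle r x ^ n)%C = on_circle (r ^ n) (INR n * x).
Proof.
  intros r x n. induction n as [|n IH].
  - simpl. unfold on_circle. rewrite Rmult_0_l, cos_0, sin_0.
    apply injective_projections; simpl; ring.
  - rewrite Cpow_S, IH, S_INR, Rmult_plus_distr_r, Rmult_1_l.
    unfold on_circle. rewrite cos_plus, sin_plus.
    apply injective_projections; simpl; ring.
Qed.

Lemma Cmod_on_circle : forall r x : R, 0 <= r -> Cmod (on_circle r x) = r.
Proof.
  intros r x Hr. unfold Cmod, on_circle. simpl.
  replace (r * cos x * (r * cos x * 1) + r * sin x * (r * sin x * 1))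
    with (r * r * (Rsqr (sin x) + Rsqr (cos x))) by (unfold Rsqr; ring).
  rewrite sin2_cos2, Rmult_1_r. now apply sqrt_square.
Qed.

Lemma is_RInt_sum_kernel :
  forall (w : nat -> C) (r : R) (n : nat) (gamma delta : R) (M : nat),
  w O = 0%C -> (1 <= n)%nat ->
  is_RInt (fun x => (1 + 2 * sum_n (fun m => Re (w m * on_circle r x ^ m)%C) M)
                    * kernel n gamma delta x) 0 (2 * PI)
    (if Nat.leb n M
     then 2 * PI * (1 + r ^ n * (Re (w n) * gamma - Im (w n) * delta))
     else 2 * PI).
Proof.
  intros w r n gamma delta M Hw0 Hn. induction M as [|M IH].
  - replace (Nat.leb n 0) with false by (symmetry; apply Nat.leb_gt; lia).
    eapply is_RInt_ext; [|apply (is_RInt_kernel n gamma delta Hn)].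
    intros x _. rewrite sum_O, Hw0. simpl. ring.
  - assert (H := is_RInt_trig_kernel (S M) n (2 * (r ^ S M * Re (w (S M))))
                   (2 * (r ^ S M * Im (w (S M)))) gamma delta ltac:(lia) Hn).
    apply (is_RInt_sum_eq _ _ _ _ _ _ _ _ IH H).
    + intros x. rewrite sum_Sn, on_circle_pow.
      unfold plus, on_circle. cbn -[INR pow kernel sum_n].
      unfold Re, Im. ring.
    + destruct (Nat.leb_spec n (S M)), (Nat.leb_spec n M),
        (Nat.eqb_spec (S M) n); try lia; subst; simpl; ring.
Qed.

Lemma Series_tail_bound : forall (a b : nat -> R) (l : R) (M : nat),
  is_series a l -> (forall k, a k <= b k) -> ex_series b ->
  l - sum_n a M <= Series b - sum_n b M.
Proof.
  intros a b l M Ha Hab [lb Hb].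
  rewrite (is_series_unique _ _ Hb).
  assert (Hd := is_series_minus _ _ _ _ Hb Ha).
  assert (Hpos : sum_n (fun n => plus (b n) (opp (a n))) M <= plus lb (opp l)).
  { apply is_lim_seq_le_loc with
      (u := fun _ : nat => sum_n (fun n => plus (b n) (opp (a n))) M)
      (v := sum_n (fun n => plus (b n) (opp (a n))))
      (l1 := Finite (sum_n (fun n => plus (b n) (opp (a n))) M))
      (l2 := Finite (plus lb (opp l))).
    - exists M. intros N HN. induction HN as [|N HN IH]; [lra|].
      rewrite sum_Sn. specialize (Hab (S N)).
      unfold plus, opp in *. simpl in *. lra.
    - apply is_lim_seq_const.
    - exact Hd. }
  assert (Hs : forall N, sum_n (fun n => plus (b n) (opp (a n))) N
                         = sum_n b N - sum_n a N).
  { induction N as [|N IH].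
    - rewrite !sum_O. reflexivity.
    - rewrite !sum_Sn, IH. unfold plus, opp. simpl. ring. }
  rewrite Hs in Hpos. unfold plus, opp in Hpos. simpl in Hpos. lra.
Qed.

Lemma one_minus_pow_ge : forall (e : R) (n : nat),
  0 <= e <= 1 -> 1 - INR n * e <= (1 - e) ^ n.
Proof.
  intros e n He. induction n as [|n IH]; [simpl; lra|].
  rewrite S_INR. simpl.
  assert (0 <= INR n) by apply pos_INR.
  apply Rle_trans with ((1 - e) * (1 - INR n * e)).
  - assert (0 <= INR n * e * e) by (repeat apply Rmult_le_pos; lra). lra.
  - apply Rmult_le_compat_l; lra.
Qed.

(** Integrate [1 + 2 Re (w z) >= 0] over the circle of radius [r] against the
    nonnegative [kernel]: this leaves
    [0 <= 1 + r^n (Re w_n * gamma - Im w_n * delta)], and for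
    [(gamma, delta) = (- Re w_n, Im w_n) / |w_n|] this reads [r^n |w_n| <= 1];
    then [r] tends to 1.  Only partial sums are integrated; they are nonnegative up to a tail that
    does not depend on the angle. *)
Lemma caratheodory_coefficient_bound : forall w : nat -> C,
  w O = 0%C ->
  (forall z : C, in_disk z ->
     exists s : C, @is_pseries C_AbsRing C_NormedModule w z s /\
                   0 <= 1 + 2 * Re s) ->
  forall n : nat, (1 <= n)%nat -> Cmod (w n) <= 1.
Proof.
  intros w Hw0 Hw n Hn.
  assert (Hconv : converges_on_disk w).
  { intros z Hz. destruct (Hw z Hz) as [s [Hs _]]. now exists s. }
  assert (Hpi := PI_RGT_0).
  assert (Hker : forall r gamma delta, 0 <= r < 1 ->
    gamma ^ 2 + delta ^ 2 <= 1 ->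
    0 <= 1 + r ^ n * (Re (w n) * gamma - Im (w n) * delta)).
  { intros r gamma delta Hr Hgd.
    (* With [(c, s)] the point of the unit circle at angle [n x],
       [0 <= (gamma + c)^2 + (delta + s)^2 <= 2 * kernel]. *)
    assert (HK : forall x, 0 <= kernel n gamma delta x).
    { intros x. unfold kernel. assert (Hsc := sin2_cos2 (INR n * x)).
      unfold Rsqr in Hsc.
      assert (0 <= (gamma + cos (INR n * x)) ^ 2
                   + (delta + sin (INR n * x)) ^ 2)
        by (apply Rplus_le_le_0_compat; apply pow2_ge_0).
      nra. }
    set (b := fun k => Cmod (w k) * r ^ k).
    assert (Hb : ex_series b) by (now apply ex_series_Cmod).
    assert (Hlow : forall M x,
      - (2 * (Series b - sum_n b M))
      <= 1 + 2 * sum_n (fun m => Re (w m * on_circle r x ^ m)%C) M).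
    { intros M x. destruct (Hw (on_circle r x)) as [s [Hs Hre]].
      { unfold in_disk. rewrite Cmod_on_circle; lra. }
      apply is_pseries_C in Hs. destruct Hs as [Hs _].
      assert (Htail := Series_tail_bound _ b _ M Hs).
      assert (Re s - sum_n (fun m => Re (w m * on_circle r x ^ m)%C) M
              <= Series b - sum_n b M); [|lra].
      apply Htail; [|exact Hb].
      intros k. eapply Rle_trans; [apply Rle_abs|].
      eapply Rle_trans; [apply re_le_Cmod|].
      rewrite Cmod_mult, Cmod_pow, Cmod_on_circle by lra.
      apply Rle_refl. }
    assert (Hint : forall M, (n <= M)%nat ->
      - (2 * (Series b - sum_n b M))
      <= 1 + r ^ n * (Re (w n) * gamma - Im (w n) * delta)).
    { intros M HM.
      assert (H := is_RInt_sum_kernel w r n gamma delta M Hw0 Hn).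
      replace (Nat.leb n M) with true in H
        by (symmetry; now apply Nat.leb_le).
      assert (H1 := is_RInt_scal _ _ _ (- (2 * (Series b - sum_n b M))) _
                      (is_RInt_kernel n gamma delta Hn)).
      assert (Hle := is_RInt_le _ _ 0 (2 * PI) _ _ ltac:(lra) H1 H).
      unfold scal in Hle. simpl in Hle. unfold mult in Hle. simpl in Hle.
      assert (Hle' : - (2 * (Series b - sum_n b M)) * (2 * PI)
        <= 2 * PI * (1 + r ^ n * (Re (w n) * gamma - Im (w n) * delta))).
      { apply Hle. intros x _. apply Rmult_le_compat_r;
          [apply HK | apply Hlow]. }
      apply Rmult_le_reg_r with (2 * PI); lra. }
    apply is_lim_seq_le_loc with
      (u := fun M => - (2 * (Series b - sum_n b M)))
      (v := fun _ : nat => 1 + r ^ n * (Re (w n) * gamma - Im (w n) * delta))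
      (l1 := Finite 0)
      (l2 := Finite (1 + r ^ n * (Re (w n) * gamma - Im (w n) * delta))).
    - exists n. exact Hint.
    - replace (Finite 0) with (Finite (- (2 * (Series b - Series b))))
        by (f_equal; ring).
      apply (is_lim_seq_continuous
               (fun y => - (2 * (Series b - y))) (sum_n b) (Series b)).
      + apply continuity_pt_filterlim.
        apply (ex_derive_continuous (fun y => - (2 * (Series b - y)))).
        auto_derive. exact I.
      + apply (Series_correct b Hb).
    - apply is_lim_seq_const. }
  assert (Hpow : forall r, 0 <= r < 1 -> r ^ n * Cmod (w n) <= 1).
  { intros r Hr. destruct (Req_dec (Cmod (w n)) 0) as [E|E].
    { rewrite E, Rmult_0_r. lra. }
    assert (H0 := Cmod_ge_0 (w n)).
    assert (Hsq := Cmod2_alt (w n)).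
    specialize (Hker r (- Re (w n) / Cmod (w n)) (Im (w n) / Cmod (w n)) Hr).
    assert (H1 : (- Re (w n) / Cmod (w n)) ^ 2 + (Im (w n) / Cmod (w n)) ^ 2
                 = 1).
    { replace 1 with ((Re (w n) ^ 2 + Im (w n) ^ 2) / Cmod (w n) ^ 2)
        by (rewrite <- Hsq; field; exact E). now field. }
    specialize (Hker ltac:(lra)).
    replace (Re (w n) * (- Re (w n) / Cmod (w n))
             - Im (w n) * (Im (w n) / Cmod (w n)))
      with (- Cmod (w n)) in Hker.
    - lra.
    - replace (- Cmod (w n)) with (- (Cmod (w n) ^ 2 / Cmod (w n)))
        by (now field).
      rewrite Hsq. now field. }
  apply Rnot_lt_le. intros Hlt.
  (* If [|w_n| > 1], the radius [1 - e] is close enough to 1 for Bernoulli's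
     inequality to give [r^n |w_n| >= (|w_n| + 1) / 2 > 1]. *)
  set (e := (1 - / Cmod (w n)) / (2 * INR n)).
  assert (Hn' : 1 <= INR n) by (apply (le_INR 1); exact Hn).
  assert (Hinv : 0 < / Cmod (w n) < 1).
  { split; [apply Rinv_0_lt_compat; lra|].
    rewrite <- Rinv_1. apply Rinv_lt_contravar; lra. }
  assert (Hne : INR n * e = (1 - / Cmod (w n)) / 2).
  { unfold e. field. split; lra. }
  assert (He : 0 < e <= 1).
  { split; [unfold e; apply Rdiv_lt_0_compat; lra|].
    apply Rle_trans with (INR n * e); [|lra].
    assert (0 <= e) by (unfold e; apply Rlt_le, Rdiv_lt_0_compat; lra). nra. }
  assert (Hbern := one_minus_pow_ge e n ltac:(lra)).
  specialize (Hpow (1 - e) ltac:(lra)). rewrite Hne in Hbern.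
  assert (Hc : (1 - (1 - / Cmod (w n)) / 2) * Cmod (w n)
               = (Cmod (w n) + 1) / 2) by (field; lra).
  assert ((1 - (1 - / Cmod (w n)) / 2) * Cmod (w n)
          <= (1 - e) ^ n * Cmod (w n))
    by (apply Rmult_le_compat_r; lra).
  lra.
Qed.

(** * Wirtinger derivatives of z h conj(g) *)

Lemma is_derive_C_id : forall z : C,
  @is_derive C_AbsRing C_NormedModule (fun y => y) z (RtoC 1).
Proof.
  intros z. split.
  - apply (@is_linear_scal_l C_AbsRing C_NormedModule).
  - intros x _ eps. apply filter_forall. intros y.
    change (Cmod (y - x - (y - x) * 1)%C <= eps * Cmod (y - x)%C).
    replace (y - x - (y - x) * 1)%C with (RtoC 0) by ring.
    rewrite Cmod_0.
    apply Rmult_le_pos; [left; apply cond_pos | apply Cmod_ge_0].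
Qed.

Lemma in_disk_near_line : forall (z v : C) (gamma : R -> C) (t : R),
  in_disk z -> gamma t = z -> Cmod v = 1 ->
  (forall h : R, gamma (t + h) = (z + RtoC h * v)%C) ->
  locally t (fun s => in_disk (gamma s)).
Proof.
  intros z v gamma t Hz Ht Hv Hgamma. unfold in_disk in *.
  assert (Hd : 0 < 1 - Cmod z) by lra.
  exists (mkposreal _ Hd). intros s Hs.
  change (Rabs (s - t) < 1 - Cmod z) in Hs.
  replace s with (t + (s - t)) by ring. rewrite Hgamma.
  eapply Rle_lt_trans; [apply Cmod_triangle|].
  rewrite Cmod_mult, Cmod_R, Hv. lra.
Qed.

(** The two summands are linear and conjugate-linear in the direction [v]: their
    coefficients are the Wirtinger derivatives, read off from [v = 1] and
    [v = i]. *)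
Lemma curve_derivative_factored :
  forall (f h g : C -> C) (z lh lg v : C) (gamma : R -> C) (t : R),
  in_disk z ->
  (forall y : C, in_disk y -> f y = (y * h y * Cconj (g y))%C) ->
  @is_derive C_AbsRing C_NormedModule h z lh ->
  @is_derive C_AbsRing C_NormedModule g z lg ->
  Cmod v = 1 -> gamma t = z ->
  (forall s : R, gamma (t + s) = (z + RtoC s * v)%C) ->
  curve_derivative (fun s => f (gamma s)) t
    (v * ((h z + z * lh) * Cconj (g z))
     + Cconj v * (z * h z * Cconj lg))%C.
Proof.
  intros f h g z lh lg v gamma t Hz Hf Hlh Hlg Hv Ht Hgamma.
  assert (Hline : forall (F : C -> C) (l : C),
    @is_derive C_AbsRing C_NormedModule F z l ->
    curve_derivative (fun s => F (gamma s)) t (l * v)%C).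
  { intros F l Hl.
    exact (curve_derivative_along_line F z l v gamma t Hl Ht Hgamma). }
  apply curve_derivative_ext_loc
    with (fun s => (gamma s * h (gamma s) * Cconj (g (gamma s)))%C).
  { generalize (in_disk_near_line z v gamma t Hz Ht Hv Hgamma).
    apply filter_imp. intros s Hs. symmetry. now apply Hf. }
  assert (H := curve_derivative_mult _ _ _ _ _
    (curve_derivative_mult _ _ _ _ _ (Hline _ _ (is_derive_C_id z))
       (Hline _ _ Hlh)) (curve_derivative_conj _ _ _ (Hline _ _ Hlg))).
  cbv beta in H. rewrite Ht, Cmult_conj in H.
  match type of H with curve_derivative _ _ ?d =>
    replace (v * ((h z + z * lh) * Cconj (g z))
             + Cconj v * (z * h z * Cconj lg))%C with d by ring end.
  exact H.
Qed.

Lemma Wirtinger_factored : forall (f h g : C -> C) (z lh lg : C),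
  in_disk z ->
  (forall y : C, in_disk y -> f y = (y * h y * Cconj (g y))%C) ->
  @is_derive C_AbsRing C_NormedModule h z lh ->
  @is_derive C_AbsRing C_NormedModule g z lg ->
  dz f z = ((h z + z * lh) * Cconj (g z))%C /\
  dzbar f z = (z * h z * Cconj lg)%C.
Proof.
  intros f h g z lh lg Hz Hf Hlh Hlg.
  destruct (curve_derivative_factored f h g z lh lg 1%C (fun s => (s, Im z))
    (Re z) Hz Hf Hlh Hlg) as [X1 X2].
  { apply Cmod_1. }
  { now destruct z. }
  { intros s. destruct z. apply injective_projections; simpl; ring. }
  destruct (curve_derivative_factored f h g z lh lg Ci (fun s => (Re z, s))
    (Im z) Hz Hf Hlh Hlg) as [Y1 Y2].
  { apply Cmod_Ci. }
  { now destruct z. }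
  { intros s. destruct z. apply injective_projections; simpl; ring. }
  apply is_derive_unique in X1, X2, Y1, Y2.
  set (p := ((h z + z * lh) * Cconj (g z))%C) in *.
  set (q := (z * h z * Cconj lg)%C) in *.
  assert (Hx : partial_x f z = (1 * p + Cconj 1 * q)%C)
    by (apply injective_projections; [exact X1 | exact X2]).
  assert (Hy : partial_y f z = (Ci * p + Cconj Ci * q)%C)
    by (apply injective_projections; [exact Y1 | exact Y2]).
  unfold dz, dzbar. rewrite Hx, Hy.
  split; apply injective_projections; simpl; field.
Qed.

(** Differentiating [h (1 - z) = g] along a horizontal line; this is the
    product rule for complex derivatives in the one case that occurs. *)
Lemma derivative_relation : forall (h g : C -> C) (z lh lg : C),
  in_disk z ->
  (forall y : C, in_disk y -> (h y * (1 - y) = g y)%C) ->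
  @is_derive C_AbsRing C_NormedModule h z lh ->
  @is_derive C_AbsRing C_NormedModule g z lg ->
  (lh * (1 - z) - h z = lg)%C.
Proof.
  intros h g z lh lg Hz Hhg Hlh Hlg.
  set (gamma := fun s : R => (z + RtoC s * 1)%C).
  assert (Ht : gamma 0 = z) by (unfold gamma; ring).
  assert (Hgamma : forall s, gamma (0 + s) = (z + RtoC s * 1)%C)
    by (intros s; unfold gamma; now rewrite Rplus_0_l).
  assert (D1 := curve_derivative_along_line h z lh 1 gamma 0 Hlh Ht Hgamma).
  assert (D2 := curve_derivative_along_line g z lg 1 gamma 0 Hlg Ht Hgamma).
  assert (D3 : curve_derivative (fun s => (1 - gamma s)%C) 0 (- (1))%C).
  { split; unfold gamma; simpl; auto_derive; try exact I; ring. }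
  assert (D4 := curve_derivative_mult _ _ _ _ _ D1 D3).
  assert (D5 : curve_derivative (fun s => g (gamma s)) 0
    (lh * 1 * (1 - gamma 0) + h (gamma 0) * - (1))%C).
  { eapply curve_derivative_ext_loc; [|exact D4].
    generalize (in_disk_near_line z 1 gamma 0 Hz Ht Cmod_1 Hgamma).
    apply filter_imp. intros s Hs. now apply Hhg. }
  assert (E := curve_derivative_unique _ _ _ _ D5 D2).
  rewrite Ht in E. rewrite <- (Cmult_1_r lg), <- E. ring.
Qed.

(** * The positive real part condition *)

Lemma Cmod_Cexp : forall s : C, Cmod (Cexp s) = exp (Re s).
Proof.
  intros s. change (Cexp s) with (on_circle (exp (Re s)) (Im s)).
  apply Cmod_on_circle. left. apply exp_pos.
Qed.

Lemma in_disk_one_minus_neq_0 : forall z : C, in_disk z -> (1 - z <> 0)%C.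
Proof.
  intros z Hz E. unfold in_disk in Hz.
  assert (Hz1 : z = RtoC 1).
  { replace z with (1 - (1 - z))%C by ring. rewrite E. ring. }
  rewrite Hz1, Cmod_1 in Hz. lra.
Qed.

Lemma Re_ge_of_Cmod_le : forall w : C,
  Cmod w <= Cmod (1 + w)%C -> 0 <= 1 + 2 * Re w.
Proof.
  intros w H.
  assert (H2 : Cmod w ^ 2 <= Cmod (1 + w)%C ^ 2)
    by (apply pow_incr; split; [apply Cmod_ge_0 | exact H]).
  rewrite !Cmod2_alt in H2. destruct w as [x y]. simpl in *. nra.
Qed.

Lemma C_Lh_h : forall (f h g : C -> C) (z : C),
  C_Lh f h g -> in_disk z -> (h z * (1 - z) = g z)%C.
Proof.
  intros f h g z [HS Hq] Hz.
  assert (H1 := in_disk_one_minus_neq_0 z Hz).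
  destruct (Ceq_dec z 0) as [->|Hz0].
  - rewrite (S_Lh_h0 _ _ _ HS), (S_Lh_g0 _ _ _ HS). ring.
  - specialize (Hq z Hz).
    destruct (S_Lh_exp_g _ _ _ HS) as [b [_ Hb]].
    destruct (Hb z Hz) as [s [_ Hs]].
    assert (Hg : g z <> 0%C).
    { apply Cmod_gt_0. rewrite Hs, Cmod_Cexp. apply exp_pos. }
    replace (h z) with (z * h z / g z * (g z / z))%C by (now field).
    rewrite Hq. now field.
Qed.

(** Since [h = g / (1 - z)], the product [h conj(g)] is [|g|^2 / (1 - z)]; in
    particular [f] has the argument of [z / (1 - z)]. *)
Lemma C_Lh_f : forall (f h g : C -> C) (z : C),
  C_Lh f h g -> in_disk z ->
  (f z = z / (1 - z) * RtoC (Cmod (g z) ^ 2))%C.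
Proof.
  intros f h g z HC Hz.
  assert (H1 := in_disk_one_minus_neq_0 z Hz).
  rewrite Cmod2_conj, <- (C_Lh_h f h g z HC Hz) at 1.
  rewrite (S_Lh_factor _ _ _ (proj1 HC) z Hz), <- (C_Lh_h f h g z HC Hz).
  now field.
Qed.

(** The coefficients of [z (1 - z) B' z] when [B z = sum b_n z^n]. *)
Definition carath_coef (b : nat -> C) (n : nat) : C :=
  match n with
  | O => 0%C
  | S k => (RtoC (INR (S k)) * b (S k) - RtoC (INR k) * b k)%C
  end.

(** With [w = z (1 - z) g' / g] one has [w = z g' / h] and
    [1 + w = (1 - z) (h + z h') / h], so that [|w| <= |1 + w|] is, up to the
    factor [|h|^2], the inequality between the moduli of the two Wirtinger
    derivatives of [f].  The point 0, where [f] vanishes and the dilatation says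
    nothing, is harmless because [w 0 = 0]. *)
Lemma C_Lh_carath : forall (f h g : C -> C) (b : nat -> C),
  C_Lh f h g ->
  (forall z : C, in_disk z ->
     exists s : C, @is_pseries C_AbsRing C_NormedModule b z s /\
                   g z = Cexp s) ->
  forall z : C, in_disk z ->
    exists s : C, @is_pseries C_AbsRing C_NormedModule (carath_coef b) z s /\
                  0 <= 1 + 2 * Re s.
Proof.
  intros f h g b HC Hb z Hz.
  assert (HS := proj1 HC).
  destruct (S_Lh_analytic_g _ _ _ HS z Hz) as [lg Hlg].
  destruct (S_Lh_analytic_h _ _ _ HS z Hz) as [lh Hlh].
  assert (Hrel := derivative_relation h g z lh lg Hz
    (fun y Hy => C_Lh_h f h g y HC Hy) Hlh Hlg).
  destruct (is_pseries_log_derivative b g z lg Hb Hz Hlg) as [Hg HD].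
  assert (H1 := in_disk_one_minus_neq_0 z Hz).
  assert (Hhg := C_Lh_h f h g z HC Hz).
  assert (Hh : h z <> 0%C).
  { intros E. apply Hg. rewrite <- Hhg, E. ring. }
  set (D := (z * lg / g z)%C) in *.
  exists ((1 - z) * D)%C. split.
  - assert (H := is_pseries_minus _ _ _ _ _ HD (is_pseries_incr_1 _ _ _ HD)).
    replace ((1 - z) * D)%C
      with (@plus C_NormedModule D (opp (@scal C_AbsRing C_NormedModule z D))).
    + eapply is_pseries_ext; [|exact H].
      intros [|n]; unfold PS_minus, PS_plus, PS_opp, PS_incr_1, carath_coef.
      * change (@eq C (RtoC (INR 0) * b O + - (RtoC 0))%C (RtoC 0)).
        simpl. ring.
      * reflexivity.
    + change (@eq C (D + - (z * D))%C ((1 - z) * D)%C). ring.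
  - apply Re_ge_of_Cmod_le.
    destruct (Ceq_dec z 0) as [Hz0|Hz0].
    { unfold D. rewrite Hz0. replace ((1 - 0) * (0 * lg / g 0))%C with (RtoC 0).
      - rewrite Cplus_0_r, Cmod_0, Cmod_1. lra.
      - unfold Cdiv. ring. }
    destruct (S_Lh_log_harmonic _ _ _ HS) as [_ [mu [_ [Hmu Heq]]]].
    destruct (Wirtinger_factored f h g z lh lg Hz
      (S_Lh_factor _ _ _ HS) Hlh Hlg) as [Edz Edzbar].
    assert (Hf : f z <> 0%C).
    { rewrite (S_Lh_factor _ _ _ HS z Hz).
      apply Cmod_gt_0. rewrite !Cmod_mult, Cmod_conj.
      repeat apply Rmult_lt_0_compat; now apply Cmod_gt_0. }
    specialize (Heq z Hz Hf). rewrite Edz, Edzbar in Heq.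
    apply (f_equal Cmod) in Heq.
    rewrite Cmod_conj in Heq. rewrite !Cmod_mult, Cmod_div, !Cmod_conj in Heq
      by exact Hf.
    unfold Rdiv in Heq.
    rewrite Rinv_r, Rmult_1_r in Heq by (now apply Rgt_not_eq, Cmod_gt_0).
    rewrite <- !Cmod_mult in Heq.
    assert (Hlt := Hmu z Hz).
    assert (E1 : ((1 - z) * D = z * lg / h z)%C).
    { unfold D. rewrite <- Hhg. field. now split. }
    assert (E2 : (1 + (1 - z) * D = (h z + z * lh) / h z * (1 - z))%C).
    { rewrite E1, <- Hrel. now field. }
    rewrite E2, E1.
    rewrite Cmod_mult, !Cmod_div, Cmod_mult in * by exact Hh.
    rewrite !Cmod_mult in Heq. rewrite <- Hhg, !Cmod_mult in Heq.
    assert (Hh' := proj1 (Cmod_gt_0 _) Hh).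
    apply Rmult_le_reg_r with (Cmod (h z) * Cmod (h z)); [nra|].
    replace (Cmod z * Cmod lg / Cmod (h z) * (Cmod (h z) * Cmod (h z)))
      with (Cmod z * Cmod (h z) * Cmod lg) by (field; lra).
    replace (Cmod (h z + z * lh)%C / Cmod (h z) * Cmod (1 - z)%C
             * (Cmod (h z) * Cmod (h z)))
      with (Cmod (h z + z * lh)%C * (Cmod (h z) * Cmod (1 - z)%C))
      by (field; lra).
    assert (Hnn : 0 <= Cmod (h z + z * lh)%C * (Cmod (h z) * Cmod (1 - z)%C))
      by (repeat apply Rmult_le_pos; apply Cmod_ge_0).
    rewrite Heq. nra.
Qed.

(** * Growth of g and the extremal coefficients *)

(** By telescoping, [n b_n] is the sum of the first [n] terms of
    [carath_coef b]. *)
Lemma coefficient_bound : forall b : nat -> C,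
  b O = 0%C ->
  (forall n, (1 <= n)%nat -> Cmod (carath_coef b n) <= 1) ->
  forall n, Cmod (b n) <= 1.
Proof.
  intros b Hb0 Hw n.
  assert (H : Cmod (RtoC (INR n) * b n)%C <= INR n).
  { induction n as [|n IH].
    - simpl. rewrite Cmult_0_l, Cmod_0. lra.
    - replace (RtoC (INR (S n)) * b (S n))%C
        with (carath_coef b (S n) + RtoC (INR n) * b n)%C
        by (unfold carath_coef; ring).
      eapply Rle_trans; [apply Cmod_triangle|].
      specialize (Hw (S n) ltac:(lia)). rewrite (S_INR n). lra. }
  destruct n as [|n].
  - rewrite Hb0, Cmod_0. lra.
  - assert (Hn : 0 < INR (S n)) by (apply lt_0_INR; lia).
    rewrite Cmod_mult, Cmod_R, Rabs_pos_eq in H by lra.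
    apply Rmult_le_reg_l with (INR (S n)); lra.
Qed.

Lemma is_series_le_eq : forall (a b : nat -> R) (la lb : R),
  is_series a la -> is_series b lb -> (forall n, a n <= b n) ->
  la <= lb /\ (la = lb -> forall n, a n = b n).
Proof.
  intros a b la lb Ha Hb Hab.
  assert (Htail : forall M, la - sum_n a M <= lb - sum_n b M).
  { intros M. rewrite <- (is_series_unique _ _ Hb).
    apply Series_tail_bound; auto. now exists lb. }
  assert (Hsum : forall M, sum_n a M <= sum_n b M).
  { intros M. now apply sum_n_m_le. }
  split.
  - specialize (Htail O). rewrite !sum_O in Htail. specialize (Hab O). lra.
  - intros E.
    assert (HS : forall M, sum_n a M = sum_n b M).
    { intros M. specialize (Htail M). specialize (Hsum M). lra. }
    intros [|n].
    + specialize (HS O). now rewrite !sum_O in HS.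
    + assert (H1 := HS (S n)). rewrite !sum_Sn, (HS n) in H1.
      unfold plus in H1. simpl in H1. lra.
Qed.

Lemma Re_eq_Cmod : forall (c : C) (r : R),
  Cmod c <= r -> Re c = r -> c = RtoC r.
Proof.
  intros [x y] r Hle Hre. simpl in Hre. subst x.
  assert (H0 := Cmod_ge_0 (r, y)).
  assert (H : Cmod (r, y) ^ 2 <= r ^ 2) by (apply pow_incr; lra).
  rewrite Cmod2_alt in H. simpl in H.
  assert (y = 0) by nra. now subst y.
Qed.

Lemma Re_pseries_le : forall (b : nat -> C) (z s : C),
  b O = 0%C -> (forall n, Cmod (b n) <= 1) -> in_disk z ->
  @is_pseries C_AbsRing C_NormedModule b z s ->
  Re s <= Cmod z / (1 - Cmod z) /\
  (Re s = Cmod z / (1 - Cmod z) ->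
   forall n, (1 <= n)%nat -> (b n * z ^ n)%C = RtoC (Cmod z ^ n)).
Proof.
  intros b z s Hb0 Hb Hz Hs. unfold in_disk in Hz.
  assert (H0 := Cmod_ge_0 z).
  apply is_pseries_C in Hs. destruct Hs as [Hs _].
  set (r := Cmod z) in *.
  set (c := fun n => match n with O => 0 | S _ => r ^ n end).
  assert (Hc : is_series c (r / (1 - r))).
  { apply is_series_decr_1.
    assert (Hg := is_series_scal r _ _
      (is_series_geom r ltac:(rewrite Rabs_pos_eq; lra))).
    change (is_series (fun k => r ^ S k) (r / (1 - r) + - 0)).
    rewrite Ropp_0, Rplus_0_r. exact Hg. }
  assert (Hle : forall n, Cmod (b n * z ^ n)%C <= c n).
  { intros [|n].
    - rewrite Hb0, Cmult_0_l, Cmod_0. apply Rle_refl.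
    - rewrite Cmod_mult, Cmod_pow. fold r.
      rewrite <- (Rmult_1_l (c (S n))). apply Rmult_le_compat_r; [|apply Hb].
      now apply pow_le. }
  destruct (is_series_le_eq _ _ _ _ Hs Hc) as [H1 H2].
  { intros n. eapply Rle_trans; [apply Rle_abs|].
    eapply Rle_trans; [apply re_le_Cmod | apply Hle]. }
  split; [exact H1|]. intros E n Hn. specialize (H2 E n).
  destruct n as [|n]; [lia|]. apply Re_eq_Cmod; [apply Hle | exact H2].
Qed.

(** Extremality alone gives [b_n = b_1^n] with [|b_1| = 1].  The direction is
    pinned by the second term of [carath_coef b], which equals
    [b_1 (2 b_1 - 1)]: [|2 b_1 - 1| <= 1] on the unit circle means [b_1 = 1]. *)
Lemma extremal_coefficients : forall (b : nat -> C) (z : C),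
  (forall n, (1 <= n)%nat -> Cmod (carath_coef b n) <= 1) ->
  z <> 0%C ->
  (forall n, (1 <= n)%nat -> (b n * z ^ n)%C = RtoC (Cmod z ^ n)) ->
  forall n, (1 <= n)%nat -> b n = RtoC 1.
Proof.
  intros b z Hw Hz Hb.
  assert (Hr := proj1 (Cmod_gt_0 z) Hz).
  assert (Hr' : RtoC (Cmod z) <> 0%C).
  { intros E. injection E. lra. }
  assert (Hpow : forall n, (1 <= n)%nat -> b n = (b 1%nat ^ n)%C).
  { intros n Hn.
    assert (E : (b n * z ^ n = b 1%nat ^ n * z ^ n)%C).
    { rewrite Hb by exact Hn.
      assert (E1 := Hb 1%nat (le_n _)). rewrite Cpow_1_r, pow_1 in E1.
      rewrite <- Cpow_mult_l, E1. apply RtoC_pow. }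
    apply (f_equal (fun y => y / z ^ n)%C) in E.
    assert (Hzn := Cpow_nz z n Hz).
    replace (b n) with (b n * z ^ n / z ^ n)%C by (now field).
    rewrite E. now field. }
  assert (Hb1 : Cmod (b 1%nat) = 1).
  { assert (E := f_equal Cmod (Hb 1%nat (le_n _))).
    rewrite Cpow_1_r, pow_1, Cmod_mult, Cmod_R, Rabs_pos_eq in E by lra.
    apply Rmult_eq_reg_r with (Cmod z); lra. }
  assert (Hone : b 1%nat = RtoC 1).
  { assert (H2 := Hw 2%nat ltac:(lia)).
    unfold carath_coef in H2. rewrite (Hpow 2%nat) in H2 by lia.
    replace (RtoC (INR 2) * b 1%nat ^ 2 - RtoC (INR 1) * b 1%nat)%C
      with (b 1%nat * (2 * b 1%nat - 1))%C in H2
      by (simpl; rewrite RtoC_plus; ring).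
    rewrite Cmod_mult, Hb1, Rmult_1_l in H2.
    assert (H3 : Cmod (2 * b 1%nat - 1)%C ^ 2 <= 1 ^ 2)
      by (apply pow_incr; split; [apply Cmod_ge_0 | exact H2]).
    assert (H4 := Cmod2_alt (b 1%nat)). rewrite Hb1 in H4.
    rewrite Cmod2_alt in H3. destruct (b 1%nat) as [x y]. simpl in *.
    assert (x = 1) by nra. assert (y = 0) by nra. now subst. }
  intros n Hn. now rewrite Hpow, Hone, Cpow_1_l.
Qed.

(** Subtracting [z s] from [s] leaves the series of the single monomial [z]. *)
Lemma is_pseries_geom_shifted : forall (b : nat -> C) (z s : C),
  b O = 0%C -> (forall n, (1 <= n)%nat -> b n = RtoC 1) -> in_disk z ->
  @is_pseries C_AbsRing C_NormedModule b z s -> s = (z / (1 - z))%C.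
Proof.
  intros b z s Hb0 Hb Hz Hs.
  assert (H1 := in_disk_one_minus_neq_0 z Hz).
  assert (H := is_pseries_minus _ _ _ _ _ Hs (is_pseries_incr_1 _ _ _ Hs)).
  set (d := PS_minus b (PS_incr_1 b)) in H.
  assert (Hd : forall n, d n = RtoC (if Nat.eqb n 1 then 1 else 0)).
  { intros n. change (@eq C (b n + - PS_incr_1 b n)%C
              (RtoC (if Nat.eqb n 1 then 1 else 0))).
    destruct n as [|[|n]]; unfold PS_incr_1; simpl Nat.eqb; cbv iota.
    - rewrite Hb0. change (@zero C_NormedModule) with (RtoC 0). ring.
    - rewrite Hb0, Hb by lia. ring.
    - rewrite !Hb by lia. ring. }
  assert (Hz' : @is_pseries C_AbsRing C_NormedModule d z z).
  { intros P HP. exists 1%nat. intros n Hn.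
    apply locally_singleton in HP.
    assert (E : @sum_n C_NormedModule
      (fun k => @scal C_AbsRing C_NormedModule (@pow_n C_AbsRing z k) (d k)) n
      = z).
    { induction Hn as [|n Hn IH].
      - rewrite sum_Sn, sum_O, !Hd.
        change (@eq C (1 * 0 + z * 1 * 1)%C z). ring.
      - rewrite sum_Sn, IH, Hd.
        replace (Nat.eqb (S n) 1) with false
          by (symmetry; apply Nat.eqb_neq; lia).
        change (@eq C (z + @pow_n C_AbsRing z (S n) * 0)%C z). ring. }
    rewrite E. exact HP. }
  assert (E := is_pseries_C_unique _ _ _ _ H Hz').
  change ((s + - (z * s))%C = z) in E.
  rewrite <- E at 1. field. exact H1.
Qed.

Lemma C_Lh_g_bound : forall (f h g : C -> C) (b : nat -> C) (z : C),
  C_Lh f h g ->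
  b O = 0%C ->
  (forall z : C, in_disk z ->
     exists s : C, @is_pseries C_AbsRing C_NormedModule b z s /\
                   g z = Cexp s) ->
  in_disk z ->
  Cmod (g z) <= exp (Cmod z / (1 - Cmod z)) /\
  (z <> RtoC 0 -> Cmod (g z) = exp (Cmod z / (1 - Cmod z)) ->
   rotation_of_f_half f).
Proof.
  intros f h g b z HC Hb0 Hb Hz.
  assert (Hw : forall n, (1 <= n)%nat -> Cmod (carath_coef b n) <= 1).
  { apply caratheodory_coefficient_bound; [reflexivity|].
    exact (C_Lh_carath f h g b HC Hb). }
  destruct (Hb z Hz) as [s [Hs Hgs]].
  destruct (Re_pseries_le b z s Hb0 (coefficient_bound b Hb0 Hw) Hz Hs)
    as [Hle Heq].
  rewrite Hgs, Cmod_Cexp. split.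
  - destruct Hle as [Hlt|E].
    + left. now apply exp_increasing.
    + rewrite E. apply Rle_refl.
  - intros Hz0 E. apply exp_inv in E.
    assert (Hone := extremal_coefficients b z Hw Hz0 (Heq E)).
    (* All [b_n] with [n >= 1] being 1, [f] is [f_half] itself. *)
    exists (RtoC 1). split; [apply Cmod_1|].
    intros y Hy. rewrite (C_Lh_f f h g y HC Hy).
    destruct (Hb y Hy) as [t [Ht ->]].
    rewrite Cmod_Cexp, (is_pseries_geom_shifted b y t Hb0 Hone Hy Ht).
    unfold f_half. rewrite Cmult_1_l.
    replace (Cconj 1) with (RtoC 1)
      by (apply injective_projections; simpl; ring).
    rewrite Cmult_1_l. do 2 f_equal.
    replace (2 * y / (1 - y))%C with (y / (1 - y) + y / (1 - y))%C
      by (unfold Cdiv; ring).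
    change (Re (y / (1 - y) + y / (1 - y))%C)
      with (Re (y / (1 - y))%C + Re (y / (1 - y))%C).
    rewrite exp_plus. ring.
Qed.

(** * Rotations in the class *)

Lemma rotation_identity : forall (f h g : C -> C) (eta z : C),
  C_Lh f h g -> Cmod eta = 1 -> in_disk z -> z <> 0%C ->
  f z = (Cconj eta * f_half (eta * z))%C ->
  (RtoC (Cmod (g z) ^ 2) * (1 - eta * z)
   = RtoC (exp (Re (2 * (eta * z) / (1 - eta * z))%C)) * (1 - z))%C.
Proof.
  intros f h g eta z HC Heta Hz Hz0 Hf.
  rewrite (C_Lh_f f h g z HC Hz) in Hf. unfold f_half in Hf.
  set (E := RtoC (exp (Re (2 * (eta * z) / (1 - eta * z))%C))) in *.
  assert (H1 := in_disk_one_minus_neq_0 z Hz).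
  assert (H2 : (1 - eta * z <> 0)%C).
  { apply in_disk_one_minus_neq_0. unfold in_disk in *.
    now rewrite Cmod_mult, Heta, Rmult_1_l. }
  assert (Hce : (eta * Cconj eta = 1)%C).
  { rewrite <- Cmod2_conj, Heta. now rewrite pow1. }
  replace (Cconj eta * (eta * z / (1 - eta * z) * E))%C
    with ((eta * Cconj eta) * (z / (1 - eta * z) * E))%C in Hf
    by (unfold Cdiv; ring).
  rewrite Hce, Cmult_1_l in Hf.
  replace (RtoC (Cmod (g z) ^ 2))
    with (z / (1 - z) * RtoC (Cmod (g z) ^ 2) * ((1 - z) / z))%C by (now field).
  rewrite Hf. now field.
Qed.

(** [rotation_identity] says that [(1 - eta z) / (1 - z)] is positive.  At 1/2
    this makes [eta] real, and at i/2 it leaves only [eta = 1]. *)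
Lemma rotation_at_half : forall f h g : C -> C,
  C_Lh f h g -> rotation_of_f_half f -> Cmod (g (RtoC (/ 2))) = exp 1.
Proof.
  intros f h g HC [eta [Heta Hrot]].
  assert (Hhalf : in_disk (RtoC (/ 2))).
  { unfold in_disk. rewrite Cmod_R, Rabs_pos_eq; lra. }
  assert (Hihalf : in_disk (RtoC (/ 2) * Ci)).
  { unfold in_disk. rewrite Cmod_mult, Cmod_Ci, Cmod_R, Rabs_pos_eq; lra. }
  assert (Hhalf0 : RtoC (/ 2) <> 0%C) by (intros E; injection E; lra).
  assert (Hihalf0 : (RtoC (/ 2) * Ci)%C <> 0%C).
  { intros E. injection E. lra. }
  assert (K1 := rotation_identity f h g eta _ HC Heta Hhalf Hhalf0
                  (Hrot _ Hhalf)).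
  assert (K2 := rotation_identity f h g eta _ HC Heta Hihalf Hihalf0
                  (Hrot _ Hihalf)).
  assert (Hgpos : forall z, in_disk z -> 0 < Cmod (g z)).
  { intros z Hz. destruct (S_Lh_exp_g _ _ _ (proj1 HC)) as [b [_ Hb]].
    destruct (Hb z Hz) as [s [_ ->]]. rewrite Cmod_Cexp. apply exp_pos. }
  assert (G1 := Hgpos _ Hhalf). assert (G2 := Hgpos _ Hihalf).
  set (e2 := exp (Re (2 * (eta * (RtoC (/ 2) * Ci))
                      / (1 - eta * (RtoC (/ 2) * Ci)))%C)) in K2.
  assert (Heta1 : eta = RtoC 1).
  { assert (I1 := f_equal Im K1). assert (I2 := f_equal Im K2).
    assert (R2 := f_equal Re K2).
    apply pow_lt with (n := 2%nat) in G1. apply pow_lt with (n := 2%nat) in G2.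
    destruct eta as [a c]. cbn -[Cmod pow] in I1, I2, R2.
    assert (c = 0) by nra. subst c.
    assert (a = 1) by nra. now subst a. }
  subst eta. clear K2 e2.
  assert (Hsq : Cmod (g (RtoC (/ 2))) ^ 2 = exp 1 ^ 2).
  { replace (exp 1 ^ 2) with (exp 2)
      by (replace 2 with (1 + 1) by ring; rewrite exp_plus; ring).
    replace (2 * (1 * RtoC (/ 2)) / (1 - 1 * RtoC (/ 2)))%C with (RtoC 2) in K1
      by (rewrite RtoC_inv by lra; field; split; intros E; injection E; lra).
    apply (f_equal Re) in K1. cbn -[Cmod pow] in K1. nra. }
  apply Rsqr_inj; [lra | left; apply exp_pos |]. unfold Rsqr. lra.
Qed.

Lemma one_minus_Cmod_le : forall z : C, 1 - Cmod z <= Cmod (1 - z)%C.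
Proof.
  intros z. assert (H := Cmod_triangle (1 - z) z).
  replace (1 - z + z)%C with (RtoC 1) in H by ring. rewrite Cmod_1 in H. lra.
Qed.

Lemma C_Lh_moduli : forall (f h g : C -> C) (z : C),
  C_Lh f h g -> in_disk z ->
  Cmod (h z) = Cmod (g z) / Cmod (1 - z)%C /\
  Cmod (f z) = Cmod z / Cmod (1 - z)%C * Cmod (g z) ^ 2.
Proof.
  intros f h g z HC Hz.
  assert (H1 := in_disk_one_minus_neq_0 z Hz).
  assert (H1' := proj1 (Cmod_gt_0 _) H1). split.
  - rewrite <- (C_Lh_h f h g z HC Hz), Cmod_mult. field. lra.
  - rewrite (C_Lh_f f h g z HC Hz), Cmod_mult, Cmod_div by exact H1.
    rewrite Cmod_R, Rabs_pos_eq by apply pow2_ge_0. reflexivity.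
Qed.

(** * Growth theorem *)

Theorem theorem4p1 :
  forall f h g : C -> C,
    C_Lh f h g ->
    (forall z : C, in_disk z ->
       (Cmod (h z) <= 1 / (1 - Cmod z) * exp (Cmod z / (1 - Cmod z)))%R /\
       (Cmod (g z) <= exp (Cmod z / (1 - Cmod z)))%R /\
       (Cmod (f z) <=
          Cmod z / (1 - Cmod z) * exp (2 * Cmod z / (1 - Cmod z)))%R) /\
    ((exists z : C, in_disk z /\ z <> RtoC 0 /\
        (Cmod (h z) = 1 / (1 - Cmod z) * exp (Cmod z / (1 - Cmod z)))%R) <->
     rotation_of_f_half f) /\
    ((exists z : C, in_disk z /\ z <> RtoC 0 /\
        (Cmod (g z) = exp (Cmod z / (1 - Cmod z)))%R) <->
     rotation_of_f_half f) /\
    ((exists z : C, in_disk z /\ z <> RtoC 0 /\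
        (Cmod (f z) =
           Cmod z / (1 - Cmod z) * exp (2 * Cmod z / (1 - Cmod z)))%R) <->
     rotation_of_f_half f).
Proof.
  intros f h g HC.
  destruct (S_Lh_exp_g _ _ _ (proj1 HC)) as [b [Hb0 Hb]].
  assert (Hg := fun z => C_Lh_g_bound f h g b z HC Hb0 Hb).
  assert (Hbounds : forall z : C, in_disk z ->
    0 < 1 - Cmod z /\ / Cmod (1 - z)%C <= / (1 - Cmod z) /\
    0 < / Cmod (1 - z)%C).
  { intros z Hz. unfold in_disk in Hz. assert (H := one_minus_Cmod_le z).
    repeat split; [lra | apply Rinv_le_contravar; lra |].
    apply Rinv_0_lt_compat. lra. }
  assert (Hdouble : forall r, 0 < 1 - r ->
    exp (2 * r / (1 - r)) = exp (r / (1 - r)) ^ 2).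
  { intros r Hr. simpl. rewrite Rmult_1_r, <- exp_plus. f_equal. field. lra. }
  assert (Hhalf : in_disk (RtoC (/ 2)) /\ RtoC (/ 2) <> RtoC 0 /\
    Cmod (RtoC (/ 2)) = / 2 /\ Cmod (1 - RtoC (/ 2))%C = / 2).
  { assert (E : Cmod (RtoC (/ 2)) = / 2)
      by (rewrite Cmod_R, Rabs_pos_eq; lra).
    repeat split; [unfold in_disk; lra | intros E'; injection E'; lra | lra |].
    rewrite <- RtoC_minus, Cmod_R, Rabs_pos_eq; lra. }
  destruct Hhalf as [Hhalf [Hhalf0 [Hmod1 Hmod2]]].
  assert (Hgh : forall z, in_disk z -> 0 <= Cmod (g z))
    by (intros; apply Cmod_ge_0).
  assert (Hex : forall x, 0 < exp x) by exact exp_pos.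
  split; [|split; [|split]].
  - intros z Hz.
    destruct (C_Lh_moduli f h g z HC Hz) as [Eh Ef].
    destruct (Hbounds z Hz) as [Hr [Hle Hpos]].
    destruct (Hg z Hz) as [Hgz _].
    assert (Hz0 := Cmod_ge_0 z). specialize (Hgh z Hz).
    repeat split.
    + rewrite Eh. unfold Rdiv. rewrite Rmult_1_l, Rmult_comm.
      apply Rmult_le_compat; try assumption. lra.
    + exact Hgz.
    + rewrite Ef, Hdouble by exact Hr.
      apply Rmult_le_compat.
      * apply Rmult_le_pos; lra.
      * now apply pow_le.
      * now apply Rmult_le_compat_l.
      * apply pow_incr. lra.
  (* Equality for [h] or [f] forces equality for [g], since
     [1 - |z| <= |1 - z|]. *)
  - split.
    + intros [z [Hz [Hz0 E]]]. apply (Hg z Hz); [exact Hz0|].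
      destruct (C_Lh_moduli f h g z HC Hz) as [Eh _].
      destruct (Hbounds z Hz) as [Hr [Hle Hpos]].
      destruct (Hg z Hz) as [[Hlt|Hgz] _]; [|exact Hgz].
      exfalso. rewrite Eh in E. unfold Rdiv at 1 2 in E.
      specialize (Hex (Cmod z / (1 - Cmod z))).
      nra.
    + intros Hrot. exists (RtoC (/ 2)). split; [exact Hhalf|].
      split; [exact Hhalf0|].
      destruct (C_Lh_moduli f h g _ HC Hhalf) as [Eh _].
      rewrite Eh, (rotation_at_half f h g HC Hrot), Hmod1, Hmod2.
      replace (/ 2 / (1 - / 2)) with 1 by field. field.
  - split.
    + intros [z [Hz [Hz0 E]]]. now apply (Hg z Hz).
    + intros Hrot. exists (RtoC (/ 2)). split; [exact Hhalf|].
      split; [exact Hhalf0|].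
      rewrite (rotation_at_half f h g HC Hrot), Hmod1. f_equal. field.
  - split.
    + intros [z [Hz [Hz0 E]]]. apply (Hg z Hz); [exact Hz0|].
      destruct (C_Lh_moduli f h g z HC Hz) as [_ Ef].
      destruct (Hbounds z Hz) as [Hr [Hle Hpos]].
      destruct (Hg z Hz) as [[Hlt|Hgz] _]; [|exact Hgz].
      exfalso. rewrite Ef, Hdouble in E by exact Hr. unfold Rdiv at 1 2 in E.
      assert (Hzp := proj1 (Cmod_gt_0 z) Hz0).
      specialize (Hgh z Hz).
      specialize (Hex (Cmod z / (1 - Cmod z))).
      assert (Hsq : Cmod (g z) ^ 2 < exp (Cmod z / (1 - Cmod z)) ^ 2) by nra.
      assert (Hzi : Cmod z * / Cmod (1 - z)%C <= Cmod z * / (1 - Cmod z))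
        by nra.
      assert (0 < Cmod z * / Cmod (1 - z)%C) by nra.
      nra.
    + intros Hrot. exists (RtoC (/ 2)). split; [exact Hhalf|].
      split; [exact Hhalf0|].
      destruct (C_Lh_moduli f h g _ HC Hhalf) as [_ Ef].
      rewrite Ef, (rotation_at_half f h g HC Hrot), Hmod1, Hmod2.
      rewrite Hdouble by lra.
      replace (/ 2 / (1 - / 2)) with 1 by field. field.
Qed.
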